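(* Let $m\ge4$ and let $T^m(x)=1+\sum_{n\ge1}t_nx^n$ be the cluster generating function for the consecutive pattern $\tau_m=1\,m\,2\,3\cdots(m-2)(m-1)$ (defined in the context), which satisfies \[T^m(x) = 1 + \frac{x}{1+x}\,T^m\!\left(\frac{x}{1+x^{m-2}}\right).\] Let $B^m(x)=\frac{x}{1+x^{m-2}}$, $B^m_0(x)=x$ and $B^m_j(x)=B^m(B^m_{j-1}(x))$ for $j\ge1$. Then this functional equation has the solution \[T^m(x) = 1 + \sum_{n=0}^\infty \prod_{j=0}^n \frac{B^m_j(x)}{1+B^m_j(x)},\] the infinite sum converging as a formal power series in $x$.
   Context: For a consecutive pattern $\sigma$ of length $m$: an occurrence of $\sigma$ in a permutation is a block of $m$ consecutive positions whose entries have the same relative order as $\sigma$. A $k$-cluster of length $n\ge m$ is a permutation of $\{1,\dots,n\}$ containing precisely $k$ occurrences of $\sigma$, such that every entry lies in at least one occurrence and any two successive occurrences overlap in at least one position. Let $s_{n,k}$ be the number of $k$-clusters of length $n$, with $s_{1,0}=1$ and $s_{n,k}=0$ otherwise for $n<m$. Set $t_n=\sum_k(-1)^ks_{n,k}$ and define the cluster generating function $T(x)=1+\sum_{n\ge1}t_nx^n$. Here $\sigma=\tau_m=1\,m\,2\,3\cdots(m-1)$, e.g. $\tau_4=1423$, $\tau_5=15234$. *)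

(* Defs.v *)
From mathcomp Require Import all_boot all_order all_algebra all_fingroup.
Set Implicit Arguments. Unset Strict Implicit. Unset Printing Implicit Defensive.
Import GRing.Theory.
Local Open Scope ring_scope.

(* tau_m = 1 m 2 3 ... (m-1), written 0-based (positions and values in 0..m-1):
   tau(0)=0, tau(1)=m-1, tau(a)=a-1 for 2 <= a < m. *)
Definition tau (m a : nat) : nat :=
  if a == 0%N then 0%N else if a == 1%N then m.-1 else a.-1.

Definition pval (n : nat) (p : 'S_n) (k : nat) : nat :=
  if (insub k : option 'I_n) is Some i then val (p i) else 0%N.

Definition occ (m n : nat) (p : 'S_n) (i : nat) : bool :=
  (i + m <= n)%N &&
  [forall a : 'I_m, forall b : 'I_m,
     (pval p (i + a) < pval p (i + b))%N == (tau m a < tau m b)%N].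

Definition occs (m n : nat) (p : 'S_n) : seq nat :=
  [seq i <- iota 0 n | occ m p i].

Definition is_cluster (m n : nat) (p : 'S_n) : bool :=
  [forall j : 'I_n, has (fun i => (i <= j < i + m)%N) (occs m p)] &&
  sorted (fun i i' => (i' < i + m)%N) (occs m p).

Definition s_cl (m n k : nat) : nat :=
  if (n < m)%N then ((n == 1%N) && (k == 0%N) : nat)
  else #|[set p : 'S_n | is_cluster m p && (size (occs m p) == k)]|.

(* t_n = sum_k (-1)^k s_{n,k}  (k ranges over 0..n; s_{n,k}=0 for k>n) *)
Definition t_cl (m n : nat) : int :=
  \sum_(k < n.+1) (-1) ^+ k * (s_cl m n k)%:Z.

Definition fps := nat -> int.

Definition fone : fps := fun n => (n == 0%N)%:R.
Definition fX : fps := fun n => (n == 1%N)%:R.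
Definition fadd (a b : fps) : fps := fun n => a n + b n.
Definition fmul (a b : fps) : fps := fun n => \sum_(i < n.+1) a i * b (n - i)%N.
Definition fpow (a : fps) (k : nat) : fps := iter k (fmul a) fone.
(* composition f(g(x)); meaningful when g has zero constant term *)
Definition fcomp (f g : fps) : fps := fun n => \sum_(k < n.+1) f k * fpow g k n.
(* 1/(1+y) = sum_k (-1)^k y^k *)
Definition fgeom : fps := fun k => (-1) ^+ k.

Definition Tser (m : nat) : fps := fun n => if n == 0%N then 1 else t_cl m n.

Definition Bop (m : nat) (g : fps) : fps := fmul g (fcomp fgeom (fpow g (m - 2))).
Definition Bj (m j : nat) : fps := iter j (Bop m) fX.
Definition frac1p (g : fps) : fps := fmul g (fcomp fgeom g).
Definition Pterm (m n : nat) : fps :=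
  \big[fmul/fone]_(j < n.+1) frac1p (Bj m j).
Definition Psum (m M : nat) : fps :=
  fadd fone (\big[fadd/(fun _ => 0)]_(n < M.+1) Pterm m n).

(* Main.v *)
(* In a cluster for tau_m two successive occurrences start m-1 or m-2 positions
   apart, and every entry except the second one of each occurrence (its peak)
   lies on a single increasing chain. Deleting the part of the chain before the
   second occurrence and the first peak therefore leaves a shorter cluster, and
   the only freedom is the height of the deleted peak: it must exceed the next
   occurrence's first entry (shift m-1) or its peak (shift m-2). Iterating along
   a maximal run of r occurrences at distance m-2 gives the factor
   binomial (n'-1+r, r), n' being the length of what remains; this is the
   coefficient recurrence equivalent to T(x) = 1 + x/(1+x) T(x/(1+x^(m-2))),
   by the negative binomial series. Power series identities are checked by
   evaluation at nilpotent elements y of commutative rings, where the functional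
   equation holds exactly; substituting B_j(y) for y and iterating yields the
   sum of products up to a remainder divisible by y^(M+1). *)
Require Import Defs.
From mathcomp Require Import all_boot all_order all_algebra all_fingroup.
From mathcomp Require Import zify ring.
(* perm.v also exports a [pval]; re-importing [Defs] gives its own precedence. *)
Import Defs.
Set Implicit Arguments. Unset Strict Implicit. Unset Printing Implicit Defensive.
Import GRing.Theory.
Local Open Scope ring_scope.

(** * The pattern as an increasing chain of values *)

Definition ascending (q : nat) (f : nat -> nat) : bool :=
  all (fun a => f a < f a.+1)%N (iota 0 q).

(** Inverse of [tau m] on {0, ..., m-1}: the position at which the pattern takes the value [r]. *)
Definition tau_pos (m r : nat) : nat :=
  if r == 0%N then 0%N else if r == m.-1 then 1%N else r.+1.

(** Taking an arbitrary function instead of a permutation lets suffixes be treated without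
    renormalizing their values, since only the relative order matters. *)
Definition occ_at (m : nat) (f : nat -> nat) : bool :=
  [forall a : 'I_m, forall b : 'I_m, (f a < f b)%N == (tau m a < tau m b)%N].

Lemma ascendingP (q : nat) (f : nat -> nat) :
  reflect (forall a, (a < q)%N -> (f a < f a.+1)%N) (ascending q f).
Proof.
apply: (iffP allP) => H a; first by move=> lta; apply: (H a); rewrite mem_iota.
by rewrite mem_iota => /andP[_]; exact: H.
Qed.

Lemma ascendingS (q : nat) (f : nat -> nat) :
  ascending q.+1 f = ascending q f && (f q < f q.+1)%N.
Proof. by rewrite /ascending -[in iota _ _]addn1 iotaD all_cat /= add0n andbT. Qed.

Lemma eq_ascending (q : nat) (f g : nat -> nat) :
  (forall a b, (a <= q)%N -> (b <= q)%N -> (f a < f b)%N = (g a < g b)%N) ->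
  ascending q f = ascending q g.
Proof.
move=> H; apply: eq_in_all => a; rewrite mem_iota => /andP[_ lta].
by apply: H => //; apply: ltnW.
Qed.

Lemma ascending_lt (q : nat) (f : nat -> nat) : ascending q f ->
  forall a b, (a <= q)%N -> (b <= q)%N -> (f a < f b)%N = (a < b)%N.
Proof.
move=> /ascendingP H.
have K : forall b, (b <= q)%N -> forall a, (a < b)%N -> (f a < f b)%N.
  elim=> [//|b IH] leb a; rewrite ltnS leq_eqVlt => /orP[/eqP->|lt].
    exact: H.
  by apply: ltn_trans (H _ leb); apply: IH => //; apply: ltnW.
move=> a b lea leb; case: (ltngtP a b) => [lt|lt|->].
- by rewrite K.
- by apply/negbTE; rewrite -leqNgt ltnW ?K.
- by rewrite ltnn.
Qed.

Lemma tauK (m a : nat) : (2 < m)%N -> (a < m)%N ->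
  (tau m a < m)%N /\ tau_pos m (tau m a) = a.
Proof.
move=> hm lta; rewrite /tau /tau_pos.
by case: eqP => [->|?] /=; [lia|case: eqP => [->|?]; split; repeat case: eqP; lia].
Qed.

Lemma tau_posK (m r : nat) : (2 < m)%N -> (r < m)%N ->
  (tau_pos m r < m)%N /\ tau m (tau_pos m r) = r.
Proof.
by move=> hm ltr; rewrite /tau /tau_pos; repeat case: eqP; lia.
Qed.

(** Visiting the window in the order of the pattern's values (positions 0, 2, 3, ..., m-1, then the
    peak 1) leaves only comparisons of neighbours; an ascending chain determines all the others. *)
Lemma occ_at_ascending (m : nat) (f : nat -> nat) : (2 < m)%N ->
  occ_at m f = ascending m.-1 (fun r => f (tau_pos m r)).
Proof.
move=> hm.
apply/idP/idP => [H|/ascending_lt H].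
  apply/ascendingP => r ltr.
  have [h1 e1] := tau_posK hm (ltac:(lia) : (r < m)%N).
  have [h2 e2] := tau_posK hm (ltac:(lia) : (r.+1 < m)%N).
  move/forallP/(_ (Ordinal h1))/forallP/(_ (Ordinal h2))/eqP: H => /= ->.
  by rewrite e1 e2.
apply/forallP => a; apply/forallP => b; apply/eqP.
have [h1 e1] := tauK hm (ltn_ord a); have [h2 e2] := tauK hm (ltn_ord b).
by rewrite -(H (tau m a) (tau m b)) ?e1 ?e2 //; lia.
Qed.

(** * Clusters and the removal of their first occurrence *)

Definition occ_seq (m n : nat) (f : nat -> nat) : seq nat :=
  [seq i <- iota 0 n | (i + m <= n)%N && occ_at m (fun a => f (i + a)%N)].

Definition cluster (m n : nat) (f : nat -> nat) : bool :=
  all (fun j => has (fun i => i <= j < i + m)%N (occ_seq m n f)) (iota 0 n)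
  && sorted (fun i i' => i' < i + m)%N (occ_seq m n f).

(** Contribution of a single permutation to t_n. The case [n == 1] encodes the convention s_{1,0} =
    1, as a single entry contains no occurrence. *)
Definition weight (m n : nat) (f : nat -> nat) : int :=
  if n == 1%N then 1
  else if cluster m n f then (-1) ^+ size (occ_seq m n f) else 0.

Lemma mem_occ_seq (m n : nat) (f : nat -> nat) (i : nat) : (0 < m)%N ->
  (i \in occ_seq m n f) = (i + m <= n)%N && occ_at m (fun a => f (i + a)%N).
Proof.
by move=> hm; rewrite mem_filter mem_iota; case: leqP => //=; case: occ_at => //=; lia.
Qed.

Lemma is_cluster_cluster (m n : nat) (p : 'S_n) :
  is_cluster m p = cluster m n (pval p).
Proof.
rewrite /is_cluster /cluster; congr (_ && _).
apply/forallP/allP => [H j|H j].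
  by rewrite mem_iota => /andP[_ ltj]; exact: (H (Ordinal ltj)).
by apply: (H (val j)); rewrite mem_iota /= ltn_ord.
Qed.

(* Hence two occurrences share at most two positions: the second occurrence of a
   cluster starts m-1 or m-2 positions after the first. *)
Lemma occ_at_distance (m : nat) (f : nat -> nat) (i : nat) :
  (0 < i)%N -> (i + 2 < m)%N -> occ_at m f ->
  ~~ occ_at m (fun a => f (i + a)%N).
Proof.
move=> i0 him; rewrite !occ_at_ascending; try lia.
move=> /ascending_lt H1; apply/negP => /ascending_lt H2.
have E a b : (a < m)%N -> (b < m)%N -> (f a < f b)%N = (tau m a < tau m b)%N.
  have hm : (2 < m)%N by lia.
  move=> la lb; have [h1 e1] := tauK hm la; have [h2 e2] := tauK hm lb.
  by rewrite -(H1 (tau m a) (tau m b)) ?e1 ?e2 //; lia.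
(* Ranks 1 and m-1 of the second window sit at positions [i + 2] and [i + 1] of the first one, where
   [tau] increases because [i > 0]; the second window demands a descent there. *)
have := H2 1%N m.-1 ltac:(lia) ltac:(lia).
have -> : tau_pos m 1 = 2%N by rewrite /tau_pos; repeat case: eqP; lia.
have -> : tau_pos m m.-1 = 1%N by rewrite /tau_pos; repeat case: eqP; lia.
have -> : (1 < m.-1)%N = true by lia.
rewrite E; try lia.
by rewrite /tau; repeat case: eqP; lia.
Qed.

Lemma clusterP (m n : nat) (f : nat -> nat) :
  reflect ((forall j, (j < n)%N ->
              exists2 i, i \in occ_seq m n f & (i <= j < i + m)%N) /\
           sorted (fun i i' => i' < i + m)%N (occ_seq m n f))
          (cluster m n f).
Proof.
apply: (iffP andP) => -[H S]; split=> //.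
  move=> j ltj; apply/hasP/(allP H); by rewrite mem_iota.
by apply/allP => j; rewrite mem_iota => /andP[_ ltj]; apply/hasP/H.
Qed.

Lemma cluster_occ0 (m n : nat) (f : nat -> nat) :
  (0 < m)%N -> (0 < n)%N -> cluster m n f -> (m <= n)%N && occ_at m f.
Proof.
move=> hm hn /clusterP[/(_ 0%N hn) [i]]; rewrite mem_occ_seq //.
by case: i.
Qed.

Lemma weight_occ0 (m n : nat) (f : nat -> nat) :
  (0 < m)%N -> (1 < n)%N -> weight m n f != 0 -> (m <= n)%N && occ_at m f.
Proof.
move=> hm hn; rewrite /weight; case: (n =P 1%N) => [|_]; first by lia.
case: ifP => [cl _|_]; last by rewrite eqxx.
by apply: cluster_occ0 cl; lia.
Qed.

Lemma occ_seq_shift (m n s : nat) (f : nat -> nat) :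
  (0 < m)%N -> (m <= n)%N -> (0 < s <= n)%N -> occ_at m f ->
  (forall i, (0 < i < s)%N -> (i + m <= n)%N -> ~~ occ_at m (fun a => f (i + a)%N)) ->
  occ_seq m n f =
    0%N :: map (addn s) (occ_seq m (n - s) (fun j => f (s + j)%N)).
Proof.
move=> hm lemn /andP[s0 les] o0 noocc; rewrite /occ_seq.
rewrite -[X in iota _ X](subnKC les) iotaD filter_cat add0n.
rewrite -[X in iota X (n - s)]addn0 iotaDl filter_map -[RHS]cat1s.
congr (_ ++ _); last first.
  congr map; apply: eq_filter => i /=; congr (_ && _); first by lia.
  by apply: eq_forallb => a; apply: eq_forallb => b; rewrite !addnA.
case: s s0 les noocc => // s _ les noocc /=.
rewrite add0n lemn o0 /=; congr cons.
apply/eqP; rewrite -(negbK (_ == _)) -has_filter; apply/hasPn => i.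
rewrite mem_iota => ltis; case: leqP => //= le; exact: noocc.
Qed.

(** The first window covers every position below [s], and the only new overlap condition is [s < m],
    so coverage and overlap both reduce to the suffix. *)
Lemma cluster_shift (m n s : nat) (f : nat -> nat) :
  (3 < m)%N -> (m < n)%N -> (m - 2 <= s < m)%N -> occ_at m f ->
  (s + m <= n)%N -> occ_at m (fun j => f (s + j)%N) ->
  occ_seq m n f =
    0%N :: map (addn s) (occ_seq m (n - s) (fun j => f (s + j)%N)) ->
  cluster m n f = cluster m (n - s) (fun j => f (s + j)%N).
Proof.
move=> hm ltmn hs o0 les os E.
have [L EL] : exists L, occ_seq m (n - s) (fun j => f (s + j)%N) = 0%N :: L.
  rewrite /occ_seq.
  have -> : (n - s = (n - s).-1.+1)%N by lia.
  rewrite /= add0n.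
  have -> : (m <= (n - s).-1.+1)%N by lia.
  by rewrite os; eexists.
have S : sorted (fun i i' => i' < i + m)%N (occ_seq m n f) =
    sorted (fun i i' => i' < i + m)%N (occ_seq m (n - s) (fun j => f (s + j)%N)).
  rewrite E EL /= addn0 add0n.
  have -> /= : (s < m)%N by lia.
  transitivity (path (fun i i' => i' < i + m)%N (s + 0)%N (map (addn s) L)); first by rewrite addn0.
  by rewrite path_map; apply: eq_path => a b /=; lia.
apply/clusterP/clusterP; rewrite S => -[H srt]; split=> // j ltj.
  have [|i] := H (s + j)%N; first by lia.
  rewrite E inE => /orP[/eqP->|/mapP[i' i'in ->]] hij.
    by exists 0%N; [rewrite EL inE eqxx|lia].
  by exists i' => //; lia.
have [ltjm|lejm] := ltnP j m; first by exists 0%N; [rewrite E inE eqxx|lia].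
have [|i iin hij] := H (j - s)%N; first by lia.
exists (s + i)%N; last by lia.
by rewrite E inE map_f ?orbT.
Qed.

(** The second occurrence starts at m-1 or at m-2, never both, since those would be at distance 1.
    So at most one summand is nonzero, and dropping the first occurrence flips the sign. *)
Lemma weight_rec (m n : nat) (f : nat -> nat) : (3 < m)%N -> (m <= n)%N ->
  weight m n f = - (occ_at m f)%:R *
    (weight m (n - m + 1) (fun j => f (m.-1 + j)%N) +
     weight m (n - m + 2) (fun j => f (m - 2 + j)%N)).
Proof.
move=> hm lemn; case o0: (occ_at m f); last first.
  rewrite oppr0 mul0r; apply/eqP/negPn/negP => /weight_occ0.
  by rewrite o0 andbF => H; suff: false by []; apply: H; lia.
rewrite mulN1r.
have noocc i : (0 < i < m - 2)%N -> (i + m <= n)%N -> ~~ occ_at m (fun a => f (i + a)%N).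
  by move=> hi _; apply: occ_at_distance => //; lia.
have step s : (m - 2 <= s < m)%N -> (s + m <= n)%N ->
    occ_at m (fun j => f (s + j)%N) ->
    occ_seq m n f = 0%N :: map (addn s) (occ_seq m (n - s) (fun j => f (s + j)%N)) ->
    weight m n f = - weight m (n - s) (fun j => f (s + j)%N).
  move=> hs les os E; rewrite /weight (cluster_shift hm _ hs) //; last by lia.
  case: eqP => [|_]; first by lia.
  case: eqP => [|_]; first by lia.
  by case: ifP => _; rewrite ?oppr0 // E /= size_map exprS mulN1r.
have [/andP[le2 o2]|no2] := boolP ((m - 2 + m <= n)%N && occ_at m (fun j => f (m - 2 + j)%N)).
  rewrite (step (m - 2)%N) //; [|lia|by apply: occ_seq_shift => //; lia].
  have -> : (n - m + 2 = n - (m - 2))%N by lia.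
  have -> : weight m (n - m + 1) (fun j => f (m.-1 + j)%N) = 0; last by rewrite add0r.
  apply/eqP/negPn/negP => /weight_occ0 H.
  have /andP[_ o1] := H ltac:(lia) ltac:(lia).
  have := @occ_at_distance m _ 1 erefl ltac:(lia) o2.
  suff -> : occ_at m (fun a => f (m - 2 + (1 + a))%N) = occ_at m (fun j => f (m.-1 + j)%N) by rewrite o1.
  by apply: eq_forallb => a; apply: eq_forallb => b; congr ((f _ < f _)%N == _); lia.
have -> : weight m (n - m + 2) (fun j => f (m - 2 + j)%N) = 0.
  apply/eqP/negPn/negP => /weight_occ0 H.
  have /andP[le2 o2] := H ltac:(lia) ltac:(lia).
  by move: no2; rewrite o2 andbT; lia.
rewrite addr0.
have E : occ_seq m n f = 0%N :: map (addn m.-1) (occ_seq m (n - m.-1) (fun j => f (m.-1 + j)%N)).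
  apply: occ_seq_shift => //; try by lia.
  move=> i hi le; have [ltim|geim] := ltnP i (m - 2); first by apply: noocc => //; lia.
  have ei : i = (m - 2)%N by lia.
  by move: no2; rewrite -ei le.
have e1 : (n - m + 1 = n - m.-1)%N by lia.
(* For [n = m] the suffix from m-1 is a single entry, of weight 1 by convention, which matches a
   cluster with one occurrence. *)
case: (eqVneq n m) => [enm|nnm].
  rewrite enm /weight; case: eqP => [|_]; first by lia.
  have -> : (m - m + 1 = 1)%N by lia.
  have em : (m - m.-1 = 1)%N by lia.
  have E' : occ_seq m m f = [:: 0%N].
    rewrite -{2}enm E enm em /occ_seq /=.
    by case: leqP => //=; lia.
  suff -> : cluster m m f by rewrite E'.
  by apply/clusterP; rewrite E'; split=> // j ltj; exists 0%N; rewrite ?inE //; lia.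
rewrite e1.
have [/andP[le1 o1]|no1] := boolP ((m.-1 + m <= n)%N && occ_at m (fun j => f (m.-1 + j)%N)).
  by apply: step => //; lia.
have -> : weight m (n - m.-1) (fun j => f (m.-1 + j)%N) = 0.
  apply/eqP/negPn/negP => /weight_occ0 H.
  have /andP[le1 o1] := H ltac:(lia) ltac:(lia).
  by move: no1; rewrite o1 andbT; lia.
rewrite oppr0 /weight; case: eqP => [|_]; first by lia.
case: clusterP => // -[H S]; exfalso.
(* Position [m] lies outside the first window, so there is another occurrence; overlap forces the
   next one to start at m-1, which [no1] excludes. *)
have [|i] := H m; first by lia.
rewrite E inE => /orP[/eqP->|]; first by lia.
move: S; rewrite E; case EL: (occ_seq m (n - m.-1) _) => [//|h L] /= /andP[hS _] _ _.
have hin : h \in occ_seq m (n - m.-1) (fun j => f (m.-1 + j)%N) by rewrite EL inE eqxx.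
move: hin; rewrite mem_occ_seq; last by lia.
have -> : h = 0%N by lia.
move=> /andP[le1 o1]; move/negP: no1; apply; rewrite o1 andbT; lia.
Qed.

Lemma eq_weight (m n : nat) (f g : nat -> nat) :
  (forall a b, (a < n)%N -> (b < n)%N -> (f a < f b)%N = (g a < g b)%N) ->
  weight m n f = weight m n g.
Proof.
move=> H.
have E : occ_seq m n f = occ_seq m n g.
  apply: eq_in_filter => i _; case: leqP => //= le.
  apply: eq_forallb => a; apply: eq_forallb => b.
  by rewrite H //; have := ltn_ord a; have := ltn_ord b; lia.
by rewrite /weight /cluster E.
Qed.

Lemma weight_small (m n : nat) (f : nat -> nat) :
  (1 < n < m)%N -> weight m n f = 0.
Proof.
move=> /andP[n1 nm]; rewrite /weight; case: eqP => [|_]; first by lia.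
rewrite /cluster; case: allP => //= /(_ 0%N).
rewrite mem_iota => /(_ ltac:(lia)) /hasP[i].
by rewrite mem_occ_seq; lia.
Qed.

(** An occurrence has its minimum at its first entry, and the remaining cluster starts inside the
    first window; induction chains these minima. *)
Lemma weight_min (m n : nat) (f : nat -> nat) : (3 < m)%N ->
  weight m n f != 0 -> forall j, (j < n)%N -> (f 0 <= f j)%N.
Proof.
move=> hm; elim/ltn_ind: n f => n IH f wN0 j ltj.
have [le1|gt1] := leqP n 1; first by have -> : j = 0%N by lia.
have [ltm|lem] := ltnP n m; first by move: wN0; rewrite weight_small ?eqxx // gt1.
move: wN0; rewrite weight_rec //; case E: occ_at; last by rewrite oppr0 mul0r eqxx.
have F a : (a < m)%N -> (f 0 <= f a)%N.
  move=> lta; case: (posnP a) => [-> //|a0]; apply: ltnW.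
  have m0 : (0 < m)%N by lia.
  move: E => /forallP/(_ (Ordinal m0))/forallP/(_ (Ordinal lta))/eqP /= ->.
  by rewrite /tau; repeat case: eqP; lia.
case: (eqVneq (weight m (n - m + 1) (fun j => f (m.-1 + j)%N)) 0) => [-> | w1 _]; last first.
  have [ltjm|] := ltnP j m; first exact: F.
  move=> lejm; have := IH (n - m + 1)%N ltac:(lia) _ w1 (j - m.-1)%N.
  rewrite addn0 subnKC; last by lia.
  by move=> H; apply: leq_trans (F m.-1 _) (H _); lia.
case: (eqVneq (weight m (n - m + 2) (fun j => f (m - 2 + j)%N)) 0) => [-> | w1 _]; first by rewrite addr0 mulr0 eqxx.
have [ltjm|] := ltnP j m; first exact: F.
move=> lejm; have := IH (n - m + 2)%N ltac:(lia) _ w1 (j - (m - 2))%N.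
rewrite addn0 subnKC; last by lia.
by move=> H; apply: leq_trans (F (m - 2)%N _) (H _); lia.
Qed.

Lemma t_cl_weight (m n : nat) : (3 < m)%N -> (0 < n)%N ->
  t_cl m n = \sum_(p : 'S_n) weight m n (pval p).
Proof.
move=> hm n0; rewrite /t_cl /s_cl; case: ltnP => [ltm|lem].
  case: (eqVneq n 1%N) => [->|n1] /=.
    rewrite !big_ord_recl big_ord0 /= (eq_bigr (fun => 1)) //.
    by rewrite sumr_const card_Sn.
  rewrite !big1 // => [p _|k _]; last by rewrite mulr0.
  by rewrite weight_small; lia.
transitivity (\sum_(k < n.+1) \sum_(p : 'S_n | is_cluster m p && (size (occs m p) == k))
   (weight m n (pval p))).
  apply: eq_bigr => k _; rewrite (eq_bigr (fun => (-1) ^+ k)); last first.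
    move=> p /andP[cl /eqP <-]; rewrite /weight -is_cluster_cluster cl.
    by case: eqP => //; lia.
  by rewrite sumr_const cardsE -[RHS]mulr_natr natz.
rewrite (bigID (fun p => is_cluster m p) predT) /= [X in _ = _ + X]big1 ?addr0; last first.
  move=> p /negbTE; rewrite /weight is_cluster_cluster => ->.
  by case: eqP => //; lia.
have S (p : 'S_n) : (size (occs m p) < n.+1)%N.
  by rewrite ltnS size_filter (leq_trans (count_size _ _)) ?size_iota.
rewrite (partition_big (fun p => Ordinal (S p)) predT) //=.
Qed.

(** * Sums over permutations, split by the value at one position *)

Lemma pvalE (n : nat) (p : 'S_n) (i : 'I_n) : pval p i = p i.
Proof. by rewrite /pval valK. Qed.

Lemma pval_lift (n : nat) (i j : 'I_n.+1) (s : 'S_n) (k : nat) :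
  (k < n)%N -> pval (lift_perm i j s) (bump i k) = bump j (pval s k).
Proof.
move=> ltk; rewrite -[k]/(val (Ordinal ltk)) pvalE.
by rewrite -[bump i _]/(val (lift i (Ordinal ltk))) pvalE lift_perm_lift.
Qed.

Lemma pval_lift_id (n : nat) (i j : 'I_n.+1) (s : 'S_n) :
  pval (lift_perm i j s) i = j.
Proof. by rewrite pvalE lift_perm_id. Qed.

(** Deleting position [i] and closing the gap in the values (the map [u]) inverts [lift_perm i j] on
    permutations sending [i] to [j]. Used at position 0 to strip the chain and at position 1 to
    remove the peak. *)
Lemma sum_lift_perm (n : nat) (i : 'I_n.+1) (F : 'S_n.+1 -> int) :
  \sum_(p : 'S_n.+1) F p = \sum_(j < n.+1) \sum_(s : 'S_n) F (lift_perm i j s).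
Proof.
rewrite (partition_big (fun p : 'S_n.+1 => p i) predT) //=.
apply: eq_bigr => j _; rewrite (reindex (lift_perm i j)) /=; last first.
  pose u i (s : 'S_n.+1) k := odflt k (unlift (s i) (s (lift i k))).
  have uK i' (s : 'S_n.+1) k : lift (s i') (u i' s k) = s (lift i' k).
    rewrite /u; have := neq_lift i' k.
    by rewrite -(can_eq (permK s)) => /unlift_some[] ? ? ->.
  have inj_u : injective (u i _).
    move=> s; apply: can_inj (u (s i) s^-1%g) _ => k'.
    by rewrite {1}/u uK !permK liftK.
  exists (fun s => perm (inj_u s)) => [s _ | s].
    by apply/permP=> k'; rewrite permE /u lift_perm_lift lift_perm_id liftK.
  move/(_ =P j) => si0; apply/permP=> k.
  case: (unliftP i k) => [k'|] ->; rewrite ?lift_perm_id //.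
  by rewrite lift_perm_lift -si0 permE uK.
by apply: eq_bigl => s; rewrite lift_perm_id eqxx.
Qed.

(* Positions [0 .. q-1] carry the values [0 .. q-1] as soon as they ascend to
   a position [q] that is minimal among the remaining ones. *)
Lemma sum_strip (n q N : nat) (G : (nat -> nat) -> int) :
  n = (q + N)%N -> (0 < N)%N ->
  (forall f, G f != 0 -> forall j, (j < N)%N -> (f 0 <= f j)%N) ->
  (forall f g, (forall j, (j < N)%N -> f j = g j) -> G f = G g) ->
  \sum_(s : 'S_n) (ascending q (pval s))%:R * G (fun j => pval s (q + j)%N) =
  \sum_(s : 'S_N) G (fun j => q + pval s j)%N.
Proof.
move=> en N0; elim: q n en G => [|q IH] n en G Gmin Gext.
  rewrite {}en; apply: eq_bigr => s _; rewrite mul1r.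
  exact: Gext.
rewrite en addSn (sum_lift_perm ord0) big_ord_recl /= [X in _ + X]big1 ?addr0.
  have H := IH _ erefl (fun f => G (fun j => (f j).+1)) (fun f Gf => Gmin _ Gf).
  rewrite -H => [|f g fg]; last by apply: Gext => j ltj; rewrite fg.
  have p0 (s : 'S_(q + N)) : pval (lift_perm ord0 ord0 s) 0 = 0%N := pval_lift_id ord0 ord0 s.
  have pS (s : 'S_(q + N)) k : (k < q + N)%N -> pval (lift_perm ord0 ord0 s) k.+1 = (pval s k).+1.
    by move=> ltk; rewrite -[k.+1]/(bump (@ord0 (q + N)%N) k) pval_lift.
  apply: eq_bigr => s _; congr ((nat_of_bool _)%:R * _).
    apply/ascendingP/ascendingP => asc a lta.
      by have := asc a.+1 lta; rewrite !pS //; lia.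
    case: a lta => [|a] lta; first by rewrite p0 pS //; lia.
    by rewrite !pS; [apply: asc|lia|lia].
  by apply: Gext => j ltj; rewrite addSn pS //; lia.
(* If position 0 holds a nonzero value, the value 0 sits further right, against the ascent up to
   position [q.+1] and the minimality there. *)
move=> j _; apply: big1 => s _.
set p := lift_perm _ _ _; case asc: ascending; last by rewrite mul0r.
rewrite mul1r; apply/eqP/negPn/negP => /Gmin min.
have {}asc := ascending_lt asc.
have [i pi0] : exists i, p i = ord0 by exists ((p^-1)%g ord0); rewrite permKV.
have : (pval p 0 <= pval p i)%N.
  have [ltiq|leiq] := ltnP i q.+1.
    case: (posnP i) => [->//|i0]; rewrite ltnW // asc //; lia.
  have [|e] := posnP q.+1; first by [].
  have ltp : (pval p 0 < pval p q.+1)%N by rewrite asc.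
  have := min (i - q.+1)%N; rewrite addn0 subnKC //.
  by move=> H; apply: leq_trans (ltnW ltp) (H _); have := ltn_ord i; lia.
rewrite (pvalE p i) pi0 (pval_lift_id ord0 (lift ord0 j) s).
by [].
Qed.

(** * Binomial sums over peak heights and the coefficient recurrence *)

Lemma sum_bin_diag (N k : nat) :
  (\sum_(j < N) 'C(j + k, k) = 'C(N + k, k.+1))%N.
Proof.
elim: N => [|N IH]; first by rewrite big_ord0 bin_small.
by rewrite big_ord_recr /= IH addSn binS.
Qed.

(** Hockey-stick identity after the reversal v -> n - v: summing over a peak height [v] above the
    bound [c] raises the lower index by one. *)
Lemma sum_bin_above (n c k : nat) :
  \sum_(v < n.+1) (c < v)%:R * ('C(n - v + k, k))%:R =
  ('C(n - c + k, k.+1))%:R :> int.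
Proof.
rewrite -sum_bin_diag (big_ord_widen n.+1 (fun j => 'C(j + k, k))); last by lia.
rewrite natr_sum [RHS]big_mkcond /= (reindex_inj rev_ord_inj) /=.
apply: eq_bigr => v _; have ltv := ltn_ord v.
have -> : (n - (n.+1 - v.+1) = v)%N by lia.
have -> : (c < n.+1 - v.+1)%N = (v < n - c)%N by lia.
by case: ltnP; rewrite ?mul1r ?mul0r.
Qed.

(** The binomial counts multisets of size [k] in the n - p(1) gaps above the first peak: the
    possible heights of [k] removed peaks, each above the next one. *)
Definition peak_sum (m n k : nat) : int :=
  \sum_(p : 'S_n) weight m n (pval p) * ('C(n.-1 - pval p 1 + k, k))%:R.

Lemma weight_pval0 (m n : nat) (p : 'S_n) : (3 < m)%N -> (0 < n)%N ->
  weight m n (pval p) != 0 -> pval p 0 = 0%N.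
Proof.
move=> hm; case: n p => // n p _ /(weight_min hm) H.
have := H _ (ltn_ord ((p^-1)%g ord0)).
by rewrite pvalE permKV; case: (pval p 0).
Qed.

Lemma eq_weight_bump (m n v : nat) (f : nat -> nat) :
  weight m n (fun j => bump v (f j)) = weight m n f.
Proof. by apply: eq_weight => a b _ _; rewrite /bump; lia. Qed.

Lemma weight_addn (m n c : nat) (f : nat -> nat) :
  weight m n (fun j => c + f j)%N = weight m n f.
Proof. by apply: eq_weight => a b _ _; rewrite ltn_add2l. Qed.

Lemma weight_lt01 (m n : nat) (f : nat -> nat) : (3 < m)%N ->
  weight m n.+2 f != 0 -> (f 0 < f 1)%N.
Proof.
move=> hm /weight_occ0 H; have /andP[_] := H ltac:(lia) ltac:(lia).
have m0 : (0 < m)%N by lia.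
have m1 : (1 < m)%N by lia.
move=> /forallP/(_ (Ordinal m0))/forallP/(_ (Ordinal m1))/eqP /= ->.
by rewrite /tau /=; lia.
Qed.

(** With the peak [v] removed, the entries before the second occurrence ascend to its first entry
    and are stripped by [sum_strip]. What must stay below [v] is that first entry (shift m-1), of
    value m-2 after stripping, or the next peak (shift m-2). *)
Lemma sum_weight_peak (m n e : nat) (i v : 'I_n.+1) : (3 < m)%N ->
  n.+1 = (m + e)%N -> i = 1%N :> nat ->
  \sum_(s : 'S_n) weight m n.+1 (pval (lift_perm i v s)) =
  - ((m - 2 < v)%N%:R * t_cl m e.+1 +
     \sum_(s : 'S_e.+2) (m - 3 + pval s 1 < v)%N%:R * weight m e.+2 (pval s)).
Proof.
move=> hm en ei.
(* [G1] and [G2] gather the conditions on the suffix. For shift m-2 the suffix starts one position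
   earlier, so [G2] also absorbs the last ascent of the chain. *)
pose G1 f := (f 0%N < v)%N%:R * weight m e.+1 f.
pose G2 f := ((f 0 < f 1) && (f 1 < v))%N%:R * weight m e.+2 f.
have E s : weight m n.+1 (pval (lift_perm i v s)) =
   - ((ascending (m - 2) (pval s))%:R * G1 (fun j => pval s (m - 2 + j)%N) +
      (ascending (m - 3) (pval s))%:R * G2 (fun j => pval s (m - 3 + j)%N)).
  have pb k : (k < n)%N -> pval (lift_perm i v s) (bump 1 k) = bump v (pval s k).
    by move=> ltk; rewrite -ei pval_lift.
  have pv : pval (lift_perm i v s) 1 = v by rewrite -[1%N]ei pval_lift_id.
  have p0 : pval (lift_perm i v s) 0 = bump v (pval s 0) by rewrite -(pb 0%N) //; lia.
  have pS k : (k.+1 < n)%N -> pval (lift_perm i v s) k.+2 = bump v (pval s k.+1).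
    by move=> ltk; rewrite -pb.
  rewrite weight_rec //; last by lia.
  have -> : (n.+1 - m + 1 = e.+1)%N by lia.
  have -> : (n.+1 - m + 2 = e.+2)%N by lia.
  rewrite (@eq_weight m e.+1 _ (fun j => bump v (pval s (m - 2 + j)%N))); last first.
    move=> a b lta ltb.
    have -> : (m.-1 + a = (m - 3 + a).+2)%N by lia.
    have -> : (m.-1 + b = (m - 3 + b).+2)%N by lia.
    rewrite !pS; try by lia.
    have ec c : ((m - 3 + c).+1 = m - 2 + c)%N by lia.
    by rewrite !ec.
  rewrite (@eq_weight m e.+2 _ (fun j => bump v (pval s (m - 3 + j)%N))); last first.
    move=> a b lta ltb.
    have -> : (m - 2 + a = (m - 4 + a).+2)%N by lia.
    have -> : (m - 2 + b = (m - 4 + b).+2)%N by lia.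
    rewrite !pS; try by lia.
    have ec c : ((m - 4 + c).+1 = m - 3 + c)%N by lia.
    by rewrite !ec.
  rewrite !eq_weight_bump.
  have -> : occ_at m (pval (lift_perm i v s)) =
      ascending (m - 2) (pval s) && (pval s (m - 2) < v)%N.
    rewrite occ_at_ascending; last by lia.
    have -> : (m.-1 = (m - 2).+1)%N by lia.
    rewrite ascendingS; congr (_ && _).
      apply: eq_ascending => a b lea leb.
      have B c : (c <= m - 2)%N ->
          pval (lift_perm i v s) (tau_pos m c) = bump v (pval s c).
        move=> lec; rewrite /tau_pos; case: eqP => [->//|c0].
        case: eqP => [?|_]; first by lia.
        by case: c c0 lec => // c _ lec; rewrite pS //; lia.
      by rewrite !B // /bump; lia.
    have -> : tau_pos m (m - 2).+1 = 1%N by rewrite /tau_pos; repeat case: eqP; lia.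
    have -> : tau_pos m (m - 2) = (m - 3).+2.
      by rewrite /tau_pos; repeat case: eqP; lia.
    rewrite pS ?pv; last by lia.
    have -> : ((m - 3).+1 = m - 2)%N by lia.
    by rewrite /bump; lia.
  have -> : ascending (m - 2) (pval s) =
      ascending (m - 3) (pval s) && (pval s (m - 3) < pval s (m - 2))%N.
    have -> : (m - 2 = (m - 3).+1)%N by lia.
    by rewrite ascendingS.
  rewrite /G1 /G2 /= !addn0.
  have -> : (m - 3 + 1 = m - 2)%N by lia.
  by case: ascending; case: (_ < _)%N; case: (_ < v)%N; rewrite /=; ring.
rewrite (eq_bigr _ (fun s _ => E s)) sumrN big_split /=; congr (- (_ + _)).
  rewrite (@sum_strip n (m - 2) e.+1) //; try by lia.
  - rewrite (t_cl_weight hm) // big_distrr /=; apply: eq_bigr => s _.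
    rewrite /G1 weight_addn; case: (eqVneq (weight m e.+1 (pval s)) 0) => [->|w0].
      by rewrite !mulr0.
    by rewrite (weight_pval0 hm _ w0) // addn0.
  - move=> f; rewrite /G1 mulf_eq0 negb_or => /andP[_ w0].
    exact: weight_min hm w0.
  - move=> f g fg; rewrite /G1 fg //; congr (_ * _).
    by apply: eq_weight => a b lta ltb; rewrite !fg.
rewrite (@sum_strip n (m - 3) e.+2) //; try by lia.
- apply: eq_bigr => s _.
  rewrite /G2 weight_addn; case: (eqVneq (weight m e.+2 (pval s)) 0) => [->|w0].
    by rewrite !mulr0.
  by rewrite ltn_add2l (weight_lt01 hm w0).
- move=> f; rewrite /G2 mulf_eq0 negb_or => /andP[_ w0].
  exact: weight_min hm w0.
- move=> f g fg; rewrite /G2 !fg //; congr (_ * _).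
  by apply: eq_weight => a b lta ltb; rewrite !fg.
Qed.

(** At shift m-1 the lower bound on the peak is constant, so a binomial factors out. At shift m-2
    the bound is the next peak, so the new binomial still depends on it and [k] grows by one. *)
Lemma peak_sum_rec (m e k : nat) : (3 < m)%N ->
  peak_sum m (m + e) k =
  - (('C(e.+1 + k, k.+1))%:R * t_cl m e.+1 + peak_sum m e.+2 k.+1).
Proof.
move=> hm; rewrite /peak_sum.
have -> : (m + e = (m + e).-1.+1)%N by lia.
set n := (m + e).-1; have en : n.+1 = (m + e)%N by lia.
have lt1 : (1 < n.+1)%N by lia.
rewrite (sum_lift_perm (Ordinal lt1)) /=.
have pv1 (v : 'I_n.+1) (s : 'S_n) : pval (lift_perm (Ordinal lt1) v s) 1 = v :=
  pval_lift_id (Ordinal lt1) v s.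
under eq_bigr => v _.
  under eq_bigr => s _ do rewrite pv1.
  rewrite -mulr_suml (sum_weight_peak _ hm en) // mulNr mulrDl.
  over.
rewrite sumrN big_split /=; congr (- (_ + _)).
  under eq_bigr => v _ do rewrite mulrAC.
  rewrite -mulr_suml sum_bin_above; congr (_%:R * _).
  by congr 'C(_, _); lia.
under eq_bigr => v _ do rewrite mulr_suml.
rewrite exchange_big /=; apply: eq_bigr => s _.
under eq_bigr => v _ do rewrite mulrAC.
rewrite -mulr_suml sum_bin_above mulrC; congr (_ * _%:R).
have : (pval s 1 < e.+2)%N by rewrite -[1%N]/(val (Ordinal (erefl : 1 < e.+2)%N)) pvalE ltn_ord.
by move=> lts; congr 'C(_, _); lia.
Qed.

Lemma peak_sum0 (m n : nat) : (3 < m)%N -> (0 < n)%N ->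
  peak_sum m n 0 = t_cl m n.
Proof.
move=> hm n0; rewrite t_cl_weight //.
by apply: eq_bigr => p _; rewrite bin0 mulr1.
Qed.

Lemma peak_sum_small (m n k : nat) : (1 < n < m)%N -> peak_sum m n k = 0.
Proof. by move=> h; apply: big1 => p _; rewrite weight_small ?mul0r. Qed.

(** Term [r] comes from [r] shifts by m-2 followed by one by m-1, which removes [r.+1] occurrences.
    [L] is a free bound on the range, so that the induction can lower it. *)
Lemma peak_sum_unroll (m n k L : nat) : (3 < m)%N -> (0 < n)%N -> (n < L)%N ->
  peak_sum m n.+1 k =
  \sum_(r < L | (r.+1 * (m - 2) < n)%N) (-1) ^+ r.+1 *
    ('C(n - r.+1 * (m - 2) + r + k, r + k.+1))%:R * t_cl m (n - r.+1 * (m - 2)).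
Proof.
move=> hm; elim/ltn_ind: n k L => n IH k [//|L] n0 ltL.
have [ltn|len] := ltnP n.+1 m.
  rewrite peak_sum_small ?ltn ?ltnS ?n0 // big1 // => r hr.
  by have := leq_ltn_trans (leq_addr _ _) (hr : (m - 2 + r * (m - 2) < n)%N); lia.
have -> : (n.+1 = m + (n.+1 - m))%N by lia.
rewrite peak_sum_rec // big_mkcond big_ord_recl /= mul1n.
have -> : (m - 2 < n)%N by lia.
have -> : (n.+1 - m).+1 = (n - (m - 2))%N by lia.
rewrite (IH _ _ k.+1 L); try by lia.
rewrite opprD expr1 mulN1r mulNr addn0 add0n; congr (_ + _).
rewrite big_mkcond -sumrN; apply: eq_bigr => r _ /=.
have -> : (r.+1 * (m - 2) < n - (m - 2))%N = ((bump 0 r).+1 * (m - 2) < n)%N.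
  by rewrite /bump /= add1n [in RHS]mulSn; lia.
case: ifP => _; last by rewrite oppr0.
have -> : (n - (m - 2) - r.+1 * (m - 2) = n - (bump 0 r).+1 * (m - 2))%N.
  by rewrite /bump /= add1n [in RHS]mulSn; lia.
rewrite /bump /= add1n [in RHS]exprS mulN1r !mulNr.
by rewrite !addnS !addSn.
Qed.

(** Coefficient of x^(n+1) in the functional equation multiplied by 1 + x. The unrolled sum gives
    the terms r >= 1, and adding [t_cl m n] supplies r = 0. *)
Lemma t_cl_rec (m n L : nat) : (3 < m)%N -> (n < L)%N ->
  t_cl m n.+1 + (0 < n)%N%:R * t_cl m n =
  (n == 0%N)%:R +
  \sum_(r < L | (r * (m - 2) < n)%N) (-1) ^+ r *
    ('C((n - r * (m - 2)).-1 + r, r))%:R * t_cl m (n - r * (m - 2)).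
Proof.
move=> hm ltL; have [->|n0] := posnP n.
  rewrite mul0r addr0 big_pred0 ?addr0 => [|r]; last by rewrite ltn0.
  rewrite t_cl_weight // (eq_bigr (fun => 1)) => [|p _] //.
  by rewrite sumr_const card_Sn.
rewrite mul1r add0r -(peak_sum0 hm) // (peak_sum_unroll 0 hm n0 ltL).
case: L ltL => // L ltL.
rewrite [in RHS]big_mkcond big_ord_recl /= mul0n n0 subn0 addn0 bin0 expr0 !mul1r.
rewrite addrC; congr (_ + _).
rewrite -[RHS]big_mkcond /= big_mkcond big_ord_recr /= [X in _ + X]ifF; last first.
  by apply/negbTE; rewrite -leqNgt; nia.
rewrite addr0 [RHS]big_mkcond; apply: eq_bigr => r _ /=.
rewrite /bump /= add1n; case: ifP => // h.
by congr (_ * (_ %:R) * _); congr 'C(_, _); lia.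
Qed.

(** * Evaluation of power series at nilpotent elements *)

Definition fps_eval (R : comNzRingType) (N : nat) (y : R) (f : fps) : R :=
  \sum_(i < N.+1) (f i)%:~R * y ^+ i.

(** The two polynomials differ by a multiple of X^(N+1), which vanishes at [y]; hence truncating a
    series after degree [N] loses nothing. *)
Lemma horner_nilpotent (R : comNzRingType) (N : nat) (y : R) (p q : {poly R}) :
  y ^+ N.+1 = 0 -> (forall i, (i <= N)%N -> p`_i = q`_i) -> p.[y] = q.[y].
Proof.
move=> y0 pq; rewrite -(poly_take_drop N.+1 p) -(poly_take_drop N.+1 q).
rewrite !hornerD !hornerM !hornerXn y0 !mulr0 !addr0; congr horner.
by apply/polyP => i; rewrite !coef_take_poly ltnS; case: leqP => // /pq.
Qed.

Lemma fps_eval_horner (R : comNzRingType) (N : nat) (y : R) (f : fps) :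
  fps_eval N y f = (\poly_(i < N.+1) (f i)%:~R).[y].
Proof. by rewrite horner_poly. Qed.

Lemma fps_evalM (R : comNzRingType) (N : nat) (y : R) (f g : fps) :
  y ^+ N.+1 = 0 ->
  fps_eval N y (fmul f g) = fps_eval N y f * fps_eval N y g.
Proof.
move=> y0; rewrite !fps_eval_horner -hornerM; apply: horner_nilpotent y0 _ => n len.
rewrite coef_poly ltnS len coefM /fmul rmorph_sum; apply: eq_bigr => i _ /=.
have lti := ltn_ord i; rewrite rmorphM !coef_poly.
have -> : (i < N.+1)%N by lia.
by have -> : (n - i < N.+1)%N by lia.
Qed.

Lemma fps_evalD (R : comNzRingType) (N : nat) (y : R) (f g : fps) :
  fps_eval N y (fadd f g) = fps_eval N y f + fps_eval N y g.
Proof.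
by rewrite /fps_eval -big_split /=; apply: eq_bigr => i _; rewrite rmorphD mulrDl.
Qed.

Lemma fps_eval_recl (R : comNzRingType) (N : nat) (y : R) (f : fps) :
  fps_eval N y f = (f 0)%:~R + y * \sum_(i < N) (f i.+1)%:~R * y ^+ i.
Proof.
rewrite /fps_eval big_ord_recl /= mulr1 big_distrr; congr (_ + _).
by apply: eq_bigr => i _; rewrite exprS mulrCA.
Qed.

Lemma fps_eval1 (R : comNzRingType) (N : nat) (y : R) : fps_eval N y fone = 1.
Proof.
by rewrite fps_eval_recl big1 ?mulr0 ?addr0 // => i _; rewrite mul0r.
Qed.

Lemma fps_evalX (R : comNzRingType) (N : nat) (y : R) :
  y ^+ N.+1 = 0 -> fps_eval N y fX = y.
Proof.
rewrite fps_eval_recl add0r; case: N => [|N]; rewrite ?expr1 => y0.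
  by rewrite y0 mul0r.
by rewrite big_ord_recl big1 ?addr0 ?mulr1 // => i _; rewrite mul0r.
Qed.

Lemma fps_eval_pow (R : comNzRingType) (N : nat) (y : R) (f : fps) (k : nat) :
  y ^+ N.+1 = 0 -> fps_eval N y (fpow f k) = fps_eval N y f ^+ k.
Proof.
move=> y0; elim: k => [|k IH]; first exact: fps_eval1.
by rewrite /fpow iterS fps_evalM // exprS -IH.
Qed.

Lemma fpow_low (f : fps) (k n : nat) : f 0%N = 0 -> (n < k)%N -> fpow f k n = 0.
Proof.
move=> f0; elim: k n => [//|k IH] n ltn.
rewrite /fpow iterS {1}/fmul big1 // => i _.
case: (posnP i) => [->|i0]; first by rewrite f0 mul0r.
by rewrite -/(fpow f k) IH ?mulr0 //; have := ltn_ord i; lia.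
Qed.

(** As [g] has no constant term, [fpow g k n] vanishes for k > n, so the inner sum extends to a
    range independent of [n] and the two sums can be exchanged. *)
Lemma fps_eval_comp (R : comNzRingType) (N : nat) (y : R) (f g : fps) :
  y ^+ N.+1 = 0 -> g 0%N = 0 ->
  fps_eval N y (fcomp f g) = fps_eval N (fps_eval N y g) f.
Proof.
move=> y0 g0; rewrite [RHS]/fps_eval.
under [RHS]eq_bigr => k _ do rewrite -(fps_eval_pow _ _ y0) big_distrr.
rewrite exchange_big; apply: eq_bigr => n _ /=.
rewrite /fcomp (big_ord_widen N.+1 (fun k => f k * fpow g k n)) // big_mkcond.
rewrite rmorph_sum big_distrl; apply: eq_bigr => k _ /=.
case: ltnP => [_|ltnk]; first by rewrite rmorphM mulrA.
by rewrite fpow_low // mul0r mulr0.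
Qed.

Lemma fps_eval_nilpotent (R : comNzRingType) (N : nat) (y : R) (g : fps) :
  y ^+ N.+1 = 0 -> g 0%N = 0 -> fps_eval N y g ^+ N.+1 = 0.
Proof. by move=> y0 g0; rewrite fps_eval_recl g0 add0r exprMn y0 mul0r. Qed.

(** Take for [y] the class of X in Z[X]/(X^(N+1)): the truncated series are their own
    representatives there, so coefficients can be read off. *)
Lemma fps_eval_inj (N : nat) (f g : fps) :
  (forall (R : comNzRingType) (y : R), y ^+ N.+1 = 0 ->
     fps_eval N y f = fps_eval N y g) ->
  f N = g N.
Proof.
pose h : {poly int} := 'X^(N.+1); pose x : {poly %/ h} := in_qpoly h 'X.
have mh : mk_monic h = h by rewrite mk_monic_Xn.
have sh : size (mk_monic h) = N.+2 by rewrite mh size_polyXn.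
have x0 : x ^+ N.+1 = 0.
  rewrite -rmorphXn; apply: val_inj => /=.
  by rewrite mh Pdiv.RingMonic.rmodpp // monicXn.
move=> /(_ _ _ x0).
have E a : fps_eval N x a = in_qpoly h (\poly_(i < N.+1) a i).
  rewrite poly_def rmorph_sum; apply: eq_bigr => i _ /=.
  by rewrite mulrzl -[in RHS](intz (a i)) scaler_int raddfMz /= rmorphXn.
have Q a : in_qpoly h (\poly_(i < N.+1) a i) = \poly_(i < N.+1) a i :> {poly int}.
  by rewrite in_qpoly_small // sh ltnS size_poly.
rewrite !E => /(congr1 (@polyn _ _)); rewrite !Q => /polyP/(_ N).
by rewrite !coef_poly ltnSn.
Qed.

Lemma fps_eval_geom (R : comNzRingType) (N : nat) (y : R) :
  y ^+ N.+1 = 0 -> (1 + y) * fps_eval N y fgeom = 1.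
Proof.
move=> y0; have := subrX1 (- y) N.+1.
rewrite exprNn y0 mulr0 sub0r => /esym H.
apply: oppr_inj; rewrite -[RHS]H -mulNr opprD [- 1 + _]addrC; congr (_ * _).
by apply: eq_bigr => i _; rewrite /fgeom rmorphXn rmorphN1 -exprNn.
Qed.

(** By Pascal's rule, multiplying the sum for [k.+1] by 1 + w gives the sum for [k]; the overflow
    term carries w^(N+1) = 0. *)
Lemma negative_binomial (R : comNzRingType) (N : nat) (w u : R) (k : nat) :
  w ^+ N.+1 = 0 -> (1 + w) * u = 1 ->
  u ^+ k.+1 = \sum_(r < N.+1) (-1) ^+ r * ('C(k + r, r))%:R * w ^+ r.
Proof.
move=> w0 wu.
suff E : u ^+ k = (1 + w) * \sum_(r < N.+1) (-1) ^+ r * ('C(k + r, r))%:R * w ^+ r.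
  by rewrite exprS E mulrA [u * _]mulrC wu mul1r.
elim: k => [|k IH].
  rewrite expr0 -[LHS](fps_eval_geom w0); congr (_ * _).
  by apply: eq_bigr => r _; rewrite binn mulr1 /fgeom rmorphXn rmorphN1.
rewrite exprS IH mulrA [u * _]mulrC wu mul1r mulrDl mul1r big_distrr /=.
rewrite [X in X + _]big_ord_recl [X in _ + X]big_ord_recr [LHS]big_ord_recl /=.
rewrite [w * (_ * w ^+ N)]mulrCA -[w * w ^+ N]exprS w0 mulr0 addr0.
rewrite !bin0 -addrA -big_split; congr (_ + _); apply: eq_bigr => r _ /=.
by rewrite /bump /= !add1n addSn [in RHS]addnS binS natrD !exprS addnS; ring.
Qed.

(** Substitute n = k + c + 1; the extra terms on the right have exponent at least N+1 and vanish. *)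
Lemma sum_reindex_shift (R : nzRingType) (N c : nat) (y : R) (X : nat -> R) :
  y ^+ N.+1 = 0 ->
  \sum_(n < N | (c < n)%N) X (n - c).-1 * y ^+ n.+1 =
  \sum_(k < N) X k * y ^+ (k + c).+2.
Proof.
move=> y0.
have E M' : \sum_(n < M' | (c < n)%N) X (n - c).-1 * y ^+ n.+1 =
            \sum_(k < M' - c.+1) X k * y ^+ (k + c).+2.
  elim: M' => [|M' IH]; first by rewrite !big_ord0.
  rewrite big_mkcond big_ord_recr -big_mkcond /= IH; case: ltnP => ltc.
    have -> : (M'.+1 - c.+1 = (M' - c.+1).+1)%N by lia.
    rewrite big_ord_recr /=; congr (_ + _).
    have -> : ((M' - c).-1 = M' - c.+1)%N by lia.
    by have -> : ((M' - c.+1 + c).+2 = M'.+1)%N by lia.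
  have -> : (M'.+1 - c.+1 = M' - c.+1)%N by lia.
  by rewrite addr0.
rewrite E (big_ord_widen N (fun k => X k * y ^+ (k + c).+2)); last by lia.
rewrite big_mkcond; apply: eq_bigr => k _; case: ltnP => // le.
have -> : ((k + c).+2 = N.+1 + (k + c - N.-1))%N by have := ltn_ord k; lia.
by rewrite exprD y0 mul0r mulr0.
Qed.

(** * The functional equation at a nilpotent element *)

Lemma Tser_functional (R : comNzRingType) (m N : nat) (y : R) :
  (3 < m)%N -> y ^+ N.+1 = 0 ->
  fps_eval N y (Tser m) =
  1 + y * fps_eval N y fgeom *
      fps_eval N (y * fps_eval N (y ^+ (m - 2)) fgeom) (Tser m).
Proof.
move=> hm y0; set u := fps_eval N (y ^+ _) _.
pose S (z : R) : R := \sum_(n < N) (t_cl m n.+1)%:~R * z ^+ n.+1.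
have TS z : fps_eval N z (Tser m) = 1 + S z.
  by rewrite /fps_eval big_ord_recl /= mulr1.
have w0 : (y ^+ (m - 2)) ^+ N.+1 = 0.
  by rewrite exprAC y0 expr0n; have -> : (m - 2 == 0)%N = false by lia.
have wu : (1 + y ^+ (m - 2)) * u = 1 by exact: fps_eval_geom.
(* Clearing the denominator 1 + y makes the coefficients those of [t_cl_rec]. *)
suff E : (1 + y) * S y = y + y * S (y * u).
  have SE : S y = fps_eval N y fgeom * (y + y * S (y * u)).
    by rewrite -E mulrA [_ * (1 + y)]mulrC fps_eval_geom // mul1r.
  by rewrite !TS SE; ring.
(* Expanding the powers of [u] by the negative binomial series, term [r] shifts the degree by
   r(m-2). *)
have RHSE : y * S (y * u) = \sum_(n < N) \sum_(r < N.+1 | (r * (m - 2) < n)%N)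
    ((-1) ^+ r * ('C((n - r * (m - 2)).-1 + r, r))%:R *
     t_cl m (n - r * (m - 2)))%:~R * y ^+ n.+1.
  under [RHS]eq_bigr do rewrite big_mkcond.
  rewrite exchange_big big_distrr /=.
  under eq_bigr => k _ do
    rewrite exprMn (negative_binomial _ w0 wu) !big_distrr /=.
  rewrite exchange_big; apply: eq_bigr => r _ /=; rewrite -big_mkcond /=.
  rewrite [LHS](eq_bigr (fun k : 'I_N => ((-1) ^+ r * ('C(k + r, r))%:R *
    t_cl m k.+1)%:~R * y ^+ (k + r * (m - 2)).+2)) => [|k _]; last first.
    rewrite !rmorphM rmorphXn rmorphN1 rmorph_nat -exprM [(_ * r)%N]mulnC.
    have -> : y ^+ (k + r * (m - 2)).+2 = y * (y ^+ k.+1 * y ^+ (r * (m - 2))).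
      by rewrite -exprD -exprS.
    by rewrite /=; ring.
  rewrite -(@sum_reindex_shift _ N (r * (m - 2)) y (fun k =>
    ((-1) ^+ r * ('C(k + r, r))%:R * t_cl m k.+1)%:~R)) //.
  apply: eq_bigr => n hn.
  by rewrite prednK // subn_gt0.
have ySE : y * S y = \sum_(n < N) ((0 < n)%N%:R * t_cl m n)%:~R * y ^+ n.+1.
  rewrite big_distrr /=.
  under eq_bigr => n _ do rewrite mulrCA -exprS -[n in y ^+ n.+2]addn0.
  rewrite -(@sum_reindex_shift _ N 0 y (fun k => (t_cl m k.+1)%:~R)) //.
  rewrite big_mkcond; apply: eq_bigr => n _; case: posnP => n0.
    by rewrite mul0r mul0r.
  by rewrite subn0 prednK // mul1r.
(* For N = 0 the sum is empty, and y = y^1 = 0. *)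
have yE : y = \sum_(n < N) (n == 0%N :> nat)%:R * y ^+ n.+1.
  case: (N) y0 => [|N'] y0; first by rewrite big_ord0 -[y]expr1.
  by rewrite big_ord_recl big1 ?addr0 ?mul1r // => n _; rewrite mul0r.
rewrite mulrDl mul1r ySE RHSE -big_split /= [X in _ = X + _]yE -big_split /=.
apply: eq_bigr => n _.
rewrite -mulrDl -rmorphD (t_cl_rec hm (ltnW (ltn_ord n) : n < N.+1)%N).
by rewrite rmorphD rmorph_nat rmorph_sum -mulr_suml mulrDl.
Qed.

(** * Iterating the substitution *)

Lemma Bj0 (m j : nat) : Bj m j 0%N = 0.
Proof.
elim: j => [//|j IH].
by rewrite /Bj iterS /Bop {1}/fmul big_ord_recl big_ord0 -/(Bj m j) IH mul0r addr0.
Qed.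

Lemma fps_eval_frac1p (R : comNzRingType) (N : nat) (y : R) (g : fps) :
  y ^+ N.+1 = 0 -> g 0%N = 0 ->
  fps_eval N y (frac1p g) = fps_eval N y g * fps_eval N (fps_eval N y g) fgeom.
Proof. by move=> y0 g0; rewrite fps_evalM // fps_eval_comp. Qed.

Lemma fps_eval_Bop (R : comNzRingType) (m N : nat) (y : R) (g : fps) :
  (2 < m)%N -> y ^+ N.+1 = 0 -> g 0%N = 0 ->
  fps_eval N y (Bop m g) = fps_eval N y g * fps_eval N (fps_eval N y g ^+ (m - 2)) fgeom.
Proof.
move=> hm y0 g0; rewrite fps_evalM // fps_eval_comp ?fps_eval_pow //.
by rewrite fpow_low //; lia.
Qed.

Lemma fps_eval_Psum (R : comNzRingType) (m N M : nat) (y : R) :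
  y ^+ N.+1 = 0 ->
  fps_eval N y (Psum m M) =
  1 + \sum_(n < M.+1) \prod_(j < n.+1) fps_eval N y (frac1p (Bj m j)).
Proof.
move=> y0; rewrite /Psum fps_evalD fps_eval1; congr (_ + _).
rewrite (big_morph _ (@fps_evalD R N y) (_ : fps_eval N y (fun => 0) = 0)).
  apply: eq_bigr => n _; rewrite /Pterm.
  apply: (big_morph _ _ (fps_eval1 N y)) => f g; exact: fps_evalM.
by apply: big1 => i _; rewrite mul0r.
Qed.

(* Convergence in the x-adic topology: every coefficient of the partial sums
   stabilizes, and its eventual value is the corresponding coefficient of T^m. *)
Theorem theorem2p9 (m : nat) (hm : (4 <= m)%N) :
  forall N : nat, exists M0 : nat, forall M : nat, (M0 <= M)%N ->
    Psum m M N = Tser m N.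
Proof.
(* M0 = N works because the remainder after M+1 iterations is divisible by y^(M+1). *)
move=> N; exists N => M leNM; apply: fps_eval_inj => R y y0.
rewrite fps_eval_Psum //.
pose b j := fps_eval N y (Bj m j); pose g j := fps_eval N y (frac1p (Bj m j)).
pose T (z : R) := fps_eval N z (Tser m).
have b0 j : b j ^+ N.+1 = 0 by apply: fps_eval_nilpotent (Bj0 m j).
have TE j : T (b j) = 1 + g j * T (b j.+1).
  rewrite /T (Tser_functional hm (b0 j)) /g fps_eval_frac1p ?Bj0 //.
  by rewrite /b [Bj m j.+1]iterS (fps_eval_Bop _ y0 (Bj0 m j)) //; lia.
(* The remainder carries T - 1 because the constant 1 of T(b K) already yields the last product in
   the sum (for K = 0, the leading 1). *)
have unroll K : T (b 0%N) =
    1 + \sum_(n < K) \prod_(j < n.+1) g j + \prod_(j < K) g j * (T (b K) - 1).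
  elim: K => [|K IH]; first by rewrite !big_ord0 addr0 mul1r addrC subrK.
  rewrite IH [in LHS]TE [in RHS]big_ord_recr /= big_ord_recr /=.
  by ring.
have by0 : b 0%N = y by apply: fps_evalX.
have := unroll M.+1; rewrite by0 -/(T y) => ->.
suff -> : \prod_(j < M.+1) g j = 0 by rewrite mul0r addr0.
(* Each factor is divisible by [y] since [Bj m j] has no constant term. *)
have gE j : exists h, g j = y * h.
  rewrite /g fps_eval_frac1p ?Bj0 // fps_eval_recl Bj0 add0r -mulrA.
  by eexists.
have [h hE] : exists h, \prod_(j < M.+1) g j = y ^+ M.+1 * h.
  elim: (M.+1) => [|K [h IH]]; first by exists 1; rewrite big_ord0 mulr1.
  rewrite big_ord_recr /= IH; have [h' ->] := gE K.
  by exists (h * h'); rewrite exprSr; ring.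
by rewrite hE -(subnKC leNM) -addSn exprD y0 !mul0r.
Qed.
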